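(* Let $n=2m$, let $r\ge 0$ be an integer, let $\Lambda\in\mathbb{F}_{2^m}[x]$ be a linearized polynomial that is a permutation of $\mathbb{F}_{2^m}$, and let $F:\mathbb{F}_{2^n}\to\mathbb{F}_{2^n}$, $F(x)=x^{2^r}\,\mathrm{Tr}^n_m(\Lambda(x))$. (i) If $m$ is odd, then the following statements are equivalent: I. $F$ has the maximal nonlinearity $\mathcal{N}_F=2^{n-1}-2^{\frac{n+m-1}{2}}$. II. $\delta_F(a,b)\in\{0,2\}$ for all $a\in\mathbb{F}_{2^n}\setminus\mathbb{F}_{2^m}$ and all $b\in\mathbb{F}_{2^n}$. III. Up to equivalence via a Frobenius automorphism and multiplication by a constant in $\mathbb{F}_{2^m}^*$, $F$ is $x^{2^{r'}}\mathrm{Tr}^n_m(x)$ with $\gcd(r',m)=1$; that is, there are integers $r',j\ge 0$ with $\gcd(r',m)=1$ and $\gamma\in\mathbb{F}_{2^m}^*$ such that $F(x)=\gamma\,G(x^{2^j})$ for all $x\in\mathbb{F}_{2^n}$, where $G(x)=x^{2^{r'}}\mathrm{Tr}^n_m(x)$. (ii) If $m$ is even, then $\delta_F(a,b)\in\{0,2\}$ for all $a\in\mathbb{F}_{2^n}\setminus\mathbb{F}_{2^m}$ and all $b\in\mathbb{F}_{2^n}$ if and only if condition III holds for $F$.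
   Context: A linearized polynomial over $\mathbb{F}_{2^m}$ is one of the form $\sum_i c_i x^{2^i}$ with $c_i\in\mathbb{F}_{2^m}$. $\mathrm{Tr}_n$ is the absolute trace of $\mathbb{F}_{2^n}$, and $\mathrm{Tr}^n_m(x)=x+x^{2^m}$ is the relative trace $\mathbb{F}_{2^n}\to\mathbb{F}_{2^m}$. $\delta_F(a,b)=|\{x\in\mathbb{F}_{2^n}: F(x+a)+F(x)=b\}|$. The nonlinearity is $\mathcal{N}_F=2^{n-1}-\frac12\max_{u\in\mathbb{F}_{2^n},\,v\in\mathbb{F}_{2^n}^*}\left|\sum_{x\in\mathbb{F}_{2^n}}(-1)^{\mathrm{Tr}_n(vF(x))+\mathrm{Tr}_n(ux)}\right|$. *)

(* Defs.v *)
From mathcomp Require Import all_boot all_order all_algebra.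
Set Implicit Arguments.
Unset Strict Implicit.
Unset Printing Implicit Defensive.
Import Order.TTheory GRing.Theory Num.Theory.
Local Open Scope ring_scope.

Definition linearized (K : fieldType) (p : {poly K}) : Prop :=
  exists (k : nat) (c : 'I_k -> K), p = \sum_(i < k) c i *: 'X^(2 ^ i).

(* Absolute trace of the field L with 2 ^ n elements, as an element of L; its
   values lie in the prime field {0, 1} of L. *)
Definition abs_trace (L : fieldType) (n : nat) (x : L) : L :=
  \sum_(i < n) x ^+ (2 ^ i).

(* Relative trace from the field L with 2 ^ (2 * m) elements to its subfield
   with 2 ^ m elements, as an element of L. *)
Definition rel_trace (L : fieldType) (m : nat) (x : L) : L := x + x ^+ (2 ^ m).

(* (-1) ^ t for t in the prime field {0, 1} of L. *)
Definition sign (L : fieldType) (t : L) : int := (-1) ^+ (t != 0 : bool).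

Definition walsh (L : finFieldType) (n : nat) (F : L -> L) (u v : L) : int :=
  \sum_(x : L) sign (abs_trace n (v * F x) + abs_trace n (u * x)).

Definition nonlinearity (L : finFieldType) (n : nat) (F : L -> L) : rat :=
  2 ^+ (n - 1) -
  2^-1 * (\max_(u : L) \max_(v : L | v != 0%R) `|walsh n F u v|%N)%:R.

Definition delta (L : finFieldType) (F : L -> L) (a b : L) : nat :=
  #|[set x : L | F (x + a) + F x == b]|.

(* Main.v *)
(* F is a quadratic map, and the polar form of F at a outside the subfield K has
   kernel a * {c in K : c^(2^r) Lam(s) = Lam(c s)}, where s is the relative trace
   of a. Hence II says that these kernels have two elements, that is, that
   t |-> Lam(t) / t^(2^r) is injective on K \ {0}.

   II -> III is Payne's theorem on linearized o-polynomials. Up to a Frobenius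
   twist r = 0; write Lam(t) = sum_i c_i t^(2^i) with i modulo m. If S is a
   nonempty proper subset of Z/m, the power sum of Lam(t) / t over K \ {0}
   with exponent sum_(a in S) 2^a vanishes; by uniqueness of binary expansions modulo
   2^m - 1 it is also a sum over the maps f : S -> S of the products of the
   conjugates of c_(f(a) - a). Taking S minimal among the sets on which some
   product is nonzero leaves a single summand, a contradiction. So only Z/m
   itself carries such a map, which forces Lam to be a monomial c t^(2^d) with d
   a generator of Z/m.

   I <-> II: the squared Walsh coefficients at v are 0 or 2^n |Rad_v|, and the
   latter is attained, where Rad_v is the radical of the form (s, t) |->
   Tr(v B(s, t)) and B is the polarization of F. Rad_v is trivial for v outside K;
   for v in K, it contains K, strictly when m is odd because 2^(3m) is then not a
   square. Counting the pairs (v, s) with s in Rad_v in two ways shows that the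
   sum of |Rad_v| over the nonzero v in K equals the sum of |ker B(a, _)| over the
   a outside K. The termwise lower bounds 2^(m+1) and 2 have equal sums as well,
   so one family is extremal iff the other is. *)
Require Import Defs.
From mathcomp Require Import all_boot all_order all_algebra.
From mathcomp Require Import all_fingroup all_solvable all_field.
From mathcomp Require Import zify ring.
Set Implicit Arguments.
Unset Strict Implicit.
Unset Printing Implicit Defensive.
Import Order.TTheory GRing.Theory Num.Theory.

(** * Binary expansions modulo [2 ^ p - 1] *)

Lemma binary_digits_inj p (f g : nat -> bool) :
  \sum_(i < p) f i * 2 ^ i = \sum_(i < p) g i * 2 ^ i ->
  forall i, i < p -> f i = g i.
Proof.
elim: p f g => // p IHp f g; rewrite !big_ord_recl /= !expn0 !muln1.
have shift (h : nat -> bool) :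
    \sum_(i < p) h (bump 0 i) * 2 ^ bump 0 i = 2 * \sum_(i < p) h i.+1 * 2 ^ i.
  by rewrite big_distrr /=; apply: eq_bigr => i _; rewrite /bump add1n expnS mulnCA.
rewrite !shift => eq_fg.
have eq0 : f 0 = g 0 by case: (f 0) (g 0) eq_fg => [] [] //=; lia.
case=> [//|i]; rewrite ltnS => lt_ip.
apply: (IHp (f \o succn) (g \o succn)) lt_ip => /=.
by move/eqP: eq_fg; rewrite eq0 eqn_add2l eqn_pmul2l // => /eqP.
Qed.

Lemma sum_expn2_ord p : \sum_(i < p) 2 ^ i = (2 ^ p).-1.
Proof. by rewrite predn_exp mul1n. Qed.

Lemma sum_expn2_inj p (A B : {set 'I_p}) :
  \sum_(i in A) 2 ^ i = \sum_(i in B) 2 ^ i -> A = B.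
Proof.
case: p A B => [|p] A B; first by move=> _; apply/setP=> -[].
have ind (C : {set 'I_p.+1}) :
    \sum_(i in C) 2 ^ i = \sum_(i < p.+1) (inord i \in C) * 2 ^ i.
  rewrite big_mkcond; apply: eq_bigr => i _; rewrite inord_val.
  by case: (i \in C); rewrite ?mul1n.
pose digit (C : {set 'I_p.+1}) i := inord i \in C.
rewrite !ind => /(@binary_digits_inj _ (digit A) (digit B)) eqAB.
by apply/setP=> i; have := eqAB i (ltn_ord i); rewrite /digit inord_val.
Qed.

(** Both sums lie between 1 and 2^p - 1, a range of pairwise distinct residues, so they are equal,
    and binary digits are unique. *)
Lemma sum_expn2_eqmod p (A B : {set 'I_p}) :
    A != set0 -> B != set0 -> B != setT ->
    \sum_(i in A) 2 ^ i = \sum_(i in B) 2 ^ i %[mod (2 ^ p).-1] ->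
  A = B.
Proof.
move=> A_n0 B_n0 B_nT eqAB.
have pos (C : {set 'I_p}) : C != set0 -> 0 < \sum_(i in C) 2 ^ i.
  by case/set0Pn=> x Cx; rewrite (bigD1 x) //= addn_gt0 expn_gt0.
have le (C : {set 'I_p}) : \sum_(i in C) 2 ^ i <= (2 ^ p).-1.
  by rewrite -sum_expn2_ord [X in _ <= X](bigID (mem C)) leq_addr.
have full (C : {set 'I_p}) : \sum_(i in C) 2 ^ i = (2 ^ p).-1 -> C = setT.
  move=> eqC; apply: sum_expn2_inj; rewrite eqC -sum_expn2_ord.
  by apply: eq_bigl => i; rewrite inE.
have ltB : \sum_(i in B) 2 ^ i < (2 ^ p).-1.
  by rewrite ltn_neqAle le andbT; apply: contra B_nT => /eqP/full->.
apply: sum_expn2_inj; move: eqAB; rewrite (modn_small ltB).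
have [/full->|neqA] := eqVneq (\sum_(i in A) 2 ^ i) (2 ^ p).-1.
  have -> : \sum_(i in [set: 'I_p]) 2 ^ i = (2 ^ p).-1.
    by rewrite -sum_expn2_ord; apply: eq_bigl => i; rewrite inE.
  by rewrite modnn => eq0; have := pos B B_n0; rewrite -eq0.
by rewrite modn_small // ltn_neqAle neqA le.
Qed.

(* Replacing two copies of 2^b by one copy of 2^(b+1), cyclically, preserves the
   value modulo 2^(p+1) - 1 and removes one summand. *)
Lemma binary_weight_min p (N : 'I_p.+1 -> nat) (S : {set 'I_p.+1}) :
    S != set0 -> S != setT -> 0 < \sum_b N b ->
    \sum_b N b * 2 ^ b = \sum_(b in S) 2 ^ b %[mod (2 ^ p.+1).-1] ->
  #|S| <= \sum_b N b /\
    (\sum_b N b = #|S| -> forall b, N b = (b \in S)).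
Proof.
move=> S_n0 S_nT; have [w] := ubnP (\sum_b N b).
elim: w N => // w IHw N ltNw N_gt0 eqN.
have [/existsP[b Nb]|/existsPn N_le1] := boolP [exists b, 1 < N b].
  (* The subtraction does not truncate, as [N b] is at least 2. [ordS] is the cyclic successor, so a
     carry out of digit p lands on digit 0. *)
  pose N' c := N c - 2 * (c == b) + (c == ordS b).
  have N'E c : N' c + (c == b) * 2 = N c + (c == ordS b).
    by rewrite /N'; case: (eqVneq c b) => [->|_]; lia.
  have sum1 d (F : 'I_p.+1 -> nat) : \sum_c (c == d) * F c = F d.
    rewrite (bigD1 d) //= eqxx mul1n big1 ?addn0 // => c /negPf->.
    by rewrite mul0n.
  have sumN' : (\sum_c N' c).+1 = \sum_c N c.
    have : \sum_c (N' c + (c == b) * 2) = \sum_c (N c + (c == ordS b) * 1).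
      by apply: eq_bigr => c _; rewrite N'E muln1.
    by rewrite !big_split /= (sum1 b (fun=> 2)) (sum1 (ordS b) (fun=> 1)); lia.
  have valN' : \sum_c N' c * 2 ^ c + 2 * 2 ^ b = \sum_c N c * 2 ^ c + 2 ^ ordS b.
    rewrite -(sum1 (ordS b) (fun c => 2 ^ c)).
    rewrite -(sum1 b (fun c => 2 * 2 ^ c)) -!big_split /=.
    by apply: eq_bigr => c _; rewrite mulnA -!mulnDl N'E.
  have eqb : 2 * 2 ^ b = 2 ^ ordS b %[mod (2 ^ p.+1).-1].
    rewrite -expnS /=; have [ltb|leb] := ltnP b.+1 p.+1.
      by rewrite [b.+1 %% _]modn_small.
    have -> : (b : nat) = p by have := ltn_ord b; lia.
    rewrite modnn expn0 -[X in X %% _ = _](prednK (_ : 0 < 2 ^ p.+1)) ?expn_gt0 //.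
    by rewrite -addn1 modnDl.
  have eqN' : \sum_b N' b * 2 ^ b = \sum_(b in S) 2 ^ b %[mod (2 ^ p.+1).-1].
    rewrite -eqN; apply/eqP; rewrite -(eqn_modDr (2 * 2 ^ b)) valN'.
    by rewrite eqn_modDl eqb.
  have N'_gt0 : 0 < \sum_c N' c.
    have : N b <= \sum_c N c by rewrite (bigD1 b) //= leq_addr.
    by rewrite -sumN' => /(leq_trans Nb).
  have [|leS _] := IHw N' _ N'_gt0 eqN'; first by rewrite -ltnS sumN'.
  rewrite -sumN'; split=> [|eqS]; first exact: leqW.
  by rewrite -eqS ltnn in leS.
pose A := [set b | N b == 1].
have NE b : N b = (b \in A) by rewrite inE; move: (N_le1 b); case: (N b) => [|[]].
have sumN : \sum_b N b = #|A|.
  rewrite -sum1_card [RHS]big_mkcond /=; apply: eq_bigr => b _.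
  by rewrite NE; case: ifP.
suff eqAS : A = S by rewrite sumN eqAS; split=> // _ b; rewrite NE eqAS.
apply: sum_expn2_eqmod => //; first by rewrite -card_gt0 -sumN.
rewrite -eqN; congr (_ %% _); rewrite [LHS]big_mkcond; apply: eq_bigr => b _.
by rewrite NE; case: ifP; rewrite ?mul1n.
Qed.

(** The values of f on S form a multiset of [#|S|] digits, the least number possible for this
    residue; by the equality case of [binary_weight_min] they are exactly the elements of S. *)
Lemma sum_expn2_stable p (S : {set 'I_p.+1}) (f : 'I_p.+1 -> 'I_p.+1) :
    S != set0 -> S != setT ->
    \sum_(a in S) 2 ^ f a = \sum_(a in S) 2 ^ a %[mod (2 ^ p.+1).-1] ->
  forall a, a \in S -> f a \in S.
Proof.
move=> S_n0 S_nT eqS; pose N b := #|[set a in S | f a == b]|.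
have sumN (F : 'I_p.+1 -> nat) : \sum_b N b * F b = \sum_(a in S) F (f a).
  rewrite [RHS](partition_big f predT) //=; apply: eq_bigr => b _.
  rewrite -sum_nat_const; apply: eq_big => [a|a]; first by rewrite inE.
  by rewrite inE => /andP[_ /eqP->].
have wN : \sum_b N b = #|S|.
  rewrite -[RHS]sum1_card -(sumN (fun=> 1)).
  by apply: eq_bigr => b _; rewrite muln1.
have [||_ /(_ wN) NE a Sa] := @binary_weight_min p N S S_n0 S_nT.
- by rewrite wN card_gt0.
- by rewrite (sumN (fun b => 2 ^ b)).
have: 0 < N (f a) by rewrite card_gt0; apply/set0Pn; exists a; rewrite inE Sa eqxx.
by rewrite NE lt0b.
Qed.

Local Open Scope ring_scope.

(** * Power sums over finite fields of characteristic 2 *)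

Lemma exprD_2pow (R : comNzRingType) (k : nat) (x y : R) :
  2 \in [pchar R] -> (x + y) ^+ (2 ^ k) = x ^+ (2 ^ k) + y ^+ (2 ^ k).
Proof. by move=> ch2; rewrite exprDn_pchar // pnatX pnatE ?ch2. Qed.

Lemma expr_2pow_sum (R : comNzRingType) (k : nat) (I : Type) (r : seq I)
    (P : pred I) (F : I -> R) :
  2 \in [pchar R] ->
  (\sum_(i <- r | P i) F i) ^+ (2 ^ k) = \sum_(i <- r | P i) F i ^+ (2 ^ k).
Proof.
move=> ch2; apply: (big_morph (fun x : R => x ^+ (2 ^ k))) => [x y|].
  exact: exprD_2pow.
by rewrite expr0n expn_eq0.
Qed.

Lemma expr_2powM (K : finFieldType) (m k : nat) (x : K) :
  #|K| = (2 ^ m)%N -> x ^+ (2 ^ (m * k)) = x.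
Proof.
move=> hK; elim: k => [|k IHk]; first by rewrite muln0 expr1.
by rewrite mulnS addnC expnD exprM IHk -hK expf_card.
Qed.

Lemma expr_2pow_mod (K : finFieldType) (m k : nat) (x : K) :
  #|K| = (2 ^ m)%N -> x ^+ (2 ^ (k %% m)) = x ^+ (2 ^ k).
Proof.
move=> hK; rewrite {2}(divn_eq k m) mulnC expnD exprM.
by rewrite (expr_2powM _ _ hK).
Qed.

Lemma expr_2pow_inj (K : finFieldType) (m k : nat) :
  #|K| = (2 ^ m)%N -> injective (fun x : K => x ^+ (2 ^ k)).
Proof.
move=> hK; have m_gt0 : (0 < m)%N.
  by case: m hK (finNzRing_gt1 K) => // ->.
apply: (can_inj (g := fun x => x ^+ (2 ^ (k * m.-1)))) => x.
by rewrite -exprM -expnD -mulnS prednK // mulnC (expr_2powM _ _ hK).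
Qed.

Lemma natr_card_finField (K : finFieldType) : #|K|%:R = 0 :> K.
Proof. by rewrite -FinRing.zmodXgE -cardsT expg_cardG ?inE. Qed.

(** X^k - 1 has at most k roots, so some unit y has y^k different from 1; substituting y x for x
    multiplies the sum by y^k. *)
Lemma sum_expr_unit (K : finFieldType) (k : nat) :
  (0 < k < #|K|.-1)%N -> \sum_(x : K | x != 0) x ^+ k = 0.
Proof.
case/andP=> k_gt0 lt_k.
have [y y_n0 yk] : exists2 y : K, y != 0 & y ^+ k != 1.
  apply/exists_inP; apply: contraT; rewrite negb_exists_in => /forall_inP y1.
  have p_n0 : 'X^k - 1 != 0 :> {poly K} by rewrite -size_poly_gt0 size_XnsubC.
  have := max_poly_roots (rs := enum (predC1 (0 : K))) p_n0.
  rewrite enum_uniq size_XnsubC // -cardE cardC1 ltnS leqNgt lt_k.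
  move=> contr; apply: contr => //; apply/allP => x.
  rewrite mem_enum => x_n0; have := y1 _ x_n0; rewrite negbK => /eqP xk.
  by rewrite rootE !hornerE xk subrr.
apply/eqP; have: (y ^+ k - 1) * \sum_(x : K | x != 0) x ^+ k == 0; last first.
  by rewrite mulf_eq0 subr_eq0 (negPf yk).
rewrite mulrBl mul1r subr_eq0 [eqbRHS](reindex_inj (mulfI y_n0)) mulr_sumr.
apply/eqP/eq_big => [x|x _]; first by rewrite mulf_eq0 (negPf y_n0).
by rewrite exprMn.
Qed.

Lemma expr_modn_unit (K : finFieldType) (e : nat) (x : K) :
  x != 0 -> x ^+ (e %% #|K|.-1) = x ^+ e.
Proof.
move=> x_n0; have x1 : x ^+ #|K|.-1 = 1.
  apply: (mulfI x_n0); rewrite -exprS prednK ?mulr1 ?expf_card //.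
  exact: ltnW (finNzRing_gt1 K).
by rewrite {2}(divn_eq e #|K|.-1) exprD mulnC exprM x1 expr1n mul1r.
Qed.

Lemma sum_expr_ratio (K : finFieldType) (e k : nat) :
  \sum_(x : K | x != 0) x ^+ e / x ^+ k =
    if e == k %[mod #|K|.-1] then -1 else 0.
Proof.
set q1 := #|K|.-1; have K_gt1 := finNzRing_gt1 K.
have q1_gt0 : (0 < q1)%N by rewrite -ltnS prednK // ltnW.
case: (eqVneq (e %% q1)%N (k %% q1)%N) => [ek|nek].
  transitivity (\sum_(x : K | x != 0) (1 : K)).
    apply: eq_bigr => x x_n0; rewrite -(expr_modn_unit e) // -(expr_modn_unit k) //.
    by rewrite -/q1 ek divff // expf_neq0.
  rewrite sumr_const cardC1 -subn1 natrB ?natr_card_finField ?sub0r //.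
  exact: ltnW (finNzRing_gt1 K).
(* As x^q1 = 1, dividing by x^k amounts to multiplying by x^(k (q1 - 1)). *)
rewrite -[RHS](@sum_expr_unit K ((e + k * q1.-1) %% q1)); last first.
  rewrite ltn_mod q1_gt0 andbT lt0n; apply: contra nek => /eqP ek.
  rewrite eq_sym -[(k %% q1)%N]/((0 + k) %% q1)%N -ek modnDml -addnA.
  by rewrite -mulnSr prednK // addnC modnMDl.
apply: eq_bigr => x x_n0; rewrite expr_modn_unit // exprD; congr (_ * _).
apply: (mulfI (expf_neq0 k x_n0)); rewrite divff ?expf_neq0 //.
by rewrite -exprD -mulnS prednK // -(expr_modn_unit _ x_n0) mulnC modnMr.
Qed.

(** * Linearized polynomials with injective quotient *)

Section Payne.
Variables (p : nat) (K : finFieldType) (c : 'I_p.+1 -> K).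
Hypothesis hK : #|K| = (2 ^ p.+1)%N.

Let P (x : K) : K := \sum_i c i * x ^+ (2 ^ i).

Hypothesis P_neq0 : forall x, x != 0 -> P x != 0.
(* Since 0^-1 = 0, this quotient is 0 at 0. *)
Hypothesis quo_inj : injective (fun x => P x / x).

Let ch2 : 2 \in [pchar K].
Proof. exact: card_finPcharP hK isT. Qed.

(** On K, Frobenius exponents count modulo p + 1, so the indices form the cyclic group ['I_p.+1] and
    raising to the power 2^a translates them by a. *)
Lemma linearized_2pow (x : K) (a : 'I_p.+1) :
  P x ^+ (2 ^ a) = \sum_b c (b - a) ^+ (2 ^ a) * x ^+ (2 ^ b).
Proof.
rewrite expr_2pow_sum // [RHS](reindex_inj (addIr a)) /=.
apply: eq_bigr => i _; rewrite addrK exprMn -exprM -expnD; congr (_ * _).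
by rewrite (expr_2pow_mod _ _ hK).
Qed.

(* Every vertex of S has an out-neighbour in S, in the Cayley digraph of the cyclic
   group 'I_p.+1 whose connection set is the support of c. *)
Definition out_closed (S : {set 'I_p.+1}) :=
  (S != set0) && [forall a in S, exists b in S, c (b - a) != 0].

Definition follows (S : {set 'I_p.+1}) (g : 'I_p.+1 -> 'I_p.+1) :=
  forall a, a \in S -> (g a \in S) && (c (g a - a) != 0).

(** The image of S is itself out-closed, since [g a] has the out-neighbour [g (g a)]; minimality
    does the rest. Hence g permutes S. *)
Lemma follows_onto (S : {set 'I_p.+1}) (g : 'I_p.+1 -> 'I_p.+1) :
  minset out_closed S -> follows S g -> g @: S = S.
Proof.
case/minsetP=> /andP[S_n0 _] minS gP; apply: minS; last first.
  by apply/subsetP=> _ /imsetP[a Sa ->]; case/andP: (gP a Sa).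
apply/andP; split.
  by case/set0Pn: S_n0 => a Sa; apply/set0Pn; exists (g a); rewrite imset_f.
apply/forall_inP=> _ /imsetP[a Sa ->]; have /andP[Sga _] := gP a Sa.
by apply/exists_inP; exists (g (g a)); [rewrite imset_f | case/andP: (gP _ Sga)].
Qed.

(* If g and h differ at a, then g with its value at a changed to h a misses g a. *)
Lemma follows_uniq (S : {set 'I_p.+1}) (g h : 'I_p.+1 -> 'I_p.+1) :
  minset out_closed S -> follows S g -> follows S h -> {in S, g =1 h}.
Proof.
move=> minS gP hP a Sa; apply: contraTeq isT => neq_gh.
pose g' x := if x == a then h x else g x.
have g'P : follows S g' by move=> x Sx; rewrite /g'; case: eqP => _; auto.
have /andP[Sga _] := gP a Sa; move: Sga; rewrite -{1}(follows_onto minS g'P).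
case/imsetP=> x Sx; rewrite /g'; case: eqVneq => [-> /eqP|neq_xa eq_g].
  by rewrite (negPf neq_gh).
have /imset_injP g_inj : #|g @: S| == #|S| by rewrite follows_onto.
by rewrite (g_inj a x Sa Sx eq_g) eqxx in neq_xa.
Qed.

(* Otherwise let S be a minimal proper out-closed set, and expand the power sum of
   P x / x with exponent the sum of the 2^a for a in S, which vanishes. A map from S
   contributes only if it follows arcs inside S, and there is exactly one such map. *)
Lemma out_closed_setT (S : {set 'I_p.+1}) : out_closed S -> S = setT.
Proof.
case/minset_exists=> S1 minS1 sS1S; suff S1T : S1 = setT.
  by apply/eqP; rewrite -subTset -S1T.
move: S1 minS1 {S sS1S} => S minS; have /minsetP[/andP[S_n0 outS] _] := minS.
apply: contraTeq isT => S_nT.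
have [f fP] : exists f, follows S f.
  exists (fun a => odflt a [pick b in S | c (b - a) != 0]) => a Sa.
  case: pickP => [b //|/= none]; have /exists_inP[b Sb cb] := forall_inP outS a Sa.
  by have := none b; rewrite Sb cb.
pose k := (\sum_(a in S) 2 ^ a)%N.
have k_bnd : (0 < k < #|K|.-1)%N.
  apply/andP; split.
    by case/set0Pn: S_n0 => a Sa; rewrite /k (bigD1 a) //= addn_gt0 expn_gt0.
  have /subsetPn[a _ Sa] : ~~ ([set: 'I_p.+1] \subset S) by rewrite subTset.
  rewrite hK -sum_expn2_ord [X in (_ < X)%N](bigID (mem S)) /= -[X in (X < _)%N]addn0.
  by rewrite ltn_add2l (bigD1 a) //= addn_gt0 expn_gt0.
(* An injective self-map of a finite set is a permutation, so the power sum may be taken over the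
   quotients P x / x. *)
have := sum_expr_unit k_bnd; rewrite (reindex_inj quo_inj) /=.
pose e (g : 'I_p.+1 -> 'I_p.+1) := (\sum_(a in S) 2 ^ g a)%N.
pose C (g : 'I_p.+1 -> 'I_p.+1) := \prod_(a in S) c (g a - a) ^+ (2 ^ a).
have term x : (P x / x) ^+ k =
    \sum_(g in pffun_on ord0 (mem S) predT) C g * (x ^+ e g / x ^+ k).
  rewrite {1}/k -prodrXr.
  transitivity (\prod_(a in S) \sum_b
      (c (b - a) ^+ (2 ^ a) * (x ^+ (2 ^ b) / x ^+ (2 ^ a)))).
    apply: eq_bigr => a _; rewrite exprMn exprVn linearized_2pow mulr_suml.
    by apply: eq_bigr => b _; rewrite mulrA.
  rewrite (big_distr_big ord0 (mem S) predT); apply: eq_bigr => g _.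
  by rewrite big_split /= prodf_div !prodrXr.
have -> : \sum_(x | P x / x != 0) (P x / x) ^+ k =
    \sum_(g in pffun_on ord0 (mem S) predT)
       C g * \sum_(x | x != 0) x ^+ e g / x ^+ k.
  under [RHS]eq_bigr do rewrite mulr_sumr.
  rewrite exchange_big /=; apply: eq_big => [x|x _]; last exact: term.
  have [->|x_n0] := eqVneq x 0; first by rewrite invr0 mulr0 eqxx.
  by rewrite mulf_neq0 ?P_neq0 ?invr_eq0.
pose g0 : {ffun 'I_p.+1 -> 'I_p.+1} := [ffun a => if a \in S then f a else ord0].
have g0P : follows S g0 by move=> a Sa; rewrite ffunE Sa; apply: fP.
have g0_on : g0 \in pffun_on ord0 (mem S) predT.
  apply/pffun_onP; split=> //; apply/supportP=> a /negPf Sa.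
  by rewrite ffunE Sa.
(* The term of [g0] is the opposite of [C g0], hence nonzero: [g0] permutes S, so [e g0 = k]. *)
rewrite (bigD1 g0) //=.
rewrite [X in _ + X]big1 => [|g /andP[/pffun_onP[/supportP g_supp _] neq_g]].
  have -> : e g0 = k.
    rewrite /k -[in RHS](follows_onto minS g0P) big_imset //=.
    by apply/imset_injP; rewrite follows_onto.
  rewrite sum_expr_ratio eqxx addr0 mulrN1 => /eqP; rewrite oppr_eq0.
  suff /negPf-> : C g0 != 0 by [].
  by apply/prodf_neq0 => a Sa; rewrite expf_neq0 //; case/andP: (g0P a Sa).
(* Any other g contributes 0: its power sum vanishes unless [e g] is congruent to k; then g maps S
   into S, and a nonzero [C g] would force g to be [g0]. *)
rewrite sum_expr_ratio hK; case: ifP => [/eqP eq_k|_]; last by rewrite mulr0.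
have gS := sum_expn2_stable S_n0 S_nT eq_k.
have [/forall_inP c_n0|] := boolP [forall a in S, c (g a - a) != 0].
  case/eqP: neq_g; apply/ffunP=> a; have [Sa|Sa] := boolP (a \in S).
    by apply: (follows_uniq minS) => // b Sb; rewrite gS ?c_n0.
  by rewrite [RHS]ffunE (negPf Sa) g_supp.
rewrite negb_forall_in => /exists_inP[a Sa]; rewrite negbK => /eqP ca.
suff -> : C g = 0 by rewrite mul0r.
by apply/eqP/prodf_eq0; exists a => //; rewrite ca expr0n expn_eq0.
Qed.

(** For d in the support, the multiples of gcd(d, p + 1) are out-closed, hence everything, so the
    gcd is 1. Two elements of the support would give two translations following the arcs of the
    minimal set [setT], against [follows_uniq]. *)
Theorem linearized_quotient_inj : exists d : 'I_p.+1,
  [/\ coprime d p.+1, c d != 0 & forall x, P x = c d * x ^+ (2 ^ d)].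
Proof.
have [/existsP[d cd]|/existsPn c0] := boolP [exists d, c d != 0]; last first.
  have /eqP[] := P_neq0 (oner_neq0 K); rewrite /P big1 // => i _.
  by have := c0 i; rewrite negbK => /eqP->; rewrite mul0r.
have closedT : out_closed setT.
  apply/andP; split; first by apply/set0Pn; exists ord0.
  by apply/forall_inP=> a _; apply/exists_inP; exists (a + d); rewrite // addrC addKr.
have minT : minset out_closed setT.
  by apply/minsetP; split=> // S /out_closed_setT.
exists d; split=> //.
  pose S := [set b : 'I_p.+1 | (gcdn d p.+1 %| b)%N].
  have /out_closed_setT ST : out_closed S.
    apply/andP; split; first by apply/set0Pn; exists ord0; rewrite inE dvdn0.
    apply/forall_inP=> a; rewrite inE => Sa; apply/exists_inP; exists (a + d).
      by rewrite inE /= /dvdn modn_dvdm ?dvdn_gcdr // -/(dvdn _ _) dvdn_add ?dvdn_gcdl.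
    by rewrite addrC addKr.
  (* Reducing 1 modulo p + 1 covers the case p = 0 as well. *)
  have : Ordinal (ltn_pmod 1 (ltn0Sn p)) \in S by rewrite ST inE.
  by rewrite inE /= /dvdn modn_dvdm ?dvdn_gcdr // -/(dvdn _ _) dvdn1.
move=> x; rewrite /P (bigD1 d) //= big1 ?addr0 // => i neq_id.
have [->|ci] := eqVneq (c i) 0; first by rewrite mul0r.
have shiftP e : c e != 0 -> follows setT (fun a => a + e).
  by move=> ce a _; rewrite inE addrC addKr.
have /addrI eq_id := follows_uniq minT (shiftP i ci) (shiftP d cd) (in_setT 0).
by rewrite eq_id eqxx in neq_id.
Qed.
End Payne.

(** * The absolute trace and additive characters *)

(** Translation by h permutes H and multiplies the sum by [psi h]. Closure under subtraction comes
    from x + x = 0. *)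
Lemma sum_character (V : finZmodType) (H : {set V}) (psi : V -> int) :
    0 \in H -> (forall x y, x \in H -> y \in H -> x + y \in H) ->
    (forall x : V, x + x = 0) -> (forall x, x \in H -> psi x != 0) ->
    {in H &, {morph psi : x y / x + y >-> x * y}} ->
  \sum_(x in H) psi x = if [forall x in H, psi x == 1] then #|H|%:R else 0.
Proof.
move=> H0 HD addxx psi_n0 psiD; case: ifP => [/forall_inP psi1|].
  by rewrite -sumr_const; apply: eq_bigr => x /psi1/eqP.
move/negbT; rewrite negb_forall_in => /exists_inP[h Hh psi_h].
apply/eqP; have: (psi h - 1) * \sum_(x in H) psi x == 0; last first.
  by rewrite mulf_eq0 subr_eq0 (negPf psi_h).
rewrite mulrBl mul1r subr_eq0 mulr_sumr [eqbRHS](reindex_inj (addrI h)).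
apply/eqP/eq_big => [x|x Hx]; last by rewrite psiD.
apply/idP/idP => [|Hhx]; first exact: HD.
by rewrite -[x]add0r -(addxx h) -addrA HD.
Qed.

Section AbsoluteTrace.
Variables (n : nat) (L : finFieldType).
Hypothesis hL : #|L| = (2 ^ n)%N.

Let ch2 : 2 \in [pchar L].
Proof. exact: card_finPcharP hL isT. Qed.

Local Notation Tr := (@abs_trace L n).

Lemma abs_traceD (x y : L) : Tr (x + y) = Tr x + Tr y.
Proof. by rewrite -big_split; apply: eq_bigr => i _; rewrite exprD_2pow. Qed.

Lemma abs_trace0 : Tr 0 = 0.
Proof. by apply: (addrI (Tr 0)); rewrite -abs_traceD !addr0. Qed.

(** Squaring shifts the summands by one place, and x^(2^n) = x closes the cycle. *)
Lemma abs_trace_sqr (x : L) : Tr x ^+ 2 = Tr x.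
Proof.
rewrite -[2%N]expn1 expr_2pow_sum //; apply: (addrI x).
have -> : x + \sum_(i < n) (x ^+ (2 ^ i)) ^+ (2 ^ 1) = \sum_(i < n.+1) x ^+ (2 ^ i).
  rewrite big_ord_recl expr1; congr (_ + _); apply: eq_bigr => i _.
  by rewrite -exprM -expnD addn1.
by rewrite big_ord_recr /= -hL expf_card addrC.
Qed.

Lemma abs_trace01 (x : L) : Tr x = 0 \/ Tr x = 1.
Proof.
have /eqP := abs_trace_sqr x; rewrite -subr_eq0 expr2 -{3}[Tr x]mulr1 -mulrBr.
by rewrite mulf_eq0 subr_eq0 => /orP[]/eqP->; [left | right].
Qed.

Lemma abs_trace_2pow (k : nat) (x : L) : Tr (x ^+ (2 ^ k)) = Tr x.
Proof.
transitivity (Tr x ^+ (2 ^ k)).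
  by rewrite expr_2pow_sum //; apply: eq_bigr => i _; rewrite exprAC.
by case: (abs_trace01 x) => ->; rewrite ?expr1n // expr0n expn_eq0.
Qed.

(** The trace is a polynomial of degree at most 2^(n-1) with linear coefficient 1, so it cannot
    vanish on all of L. *)
Lemma abs_trace_nondegenerate (w : L) : w != 0 -> exists z, Tr (w * z) != 0.
Proof.
move=> w_n0; suff [x Tx] : exists x, Tr x != 0 by exists (w^-1 * x); rewrite mulVKf.
have n_gt0 : (0 < n)%N by case: n hL (finNzRing_gt1 L) => // ->.
apply/existsP; apply: contraT => /existsPn Tr0.
pose p : {poly L} := \sum_(i < n) 'X^(2 ^ i).
have sz_p : (size p <= (2 ^ n.-1).+1)%N.
  apply: (leq_trans (size_sum _ _ _)); apply/bigmax_leqP => i _.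
  by rewrite size_polyXn ltnS leq_exp2l // -ltnS prednK.
have p_n0 : p != 0.
  apply/eqP => /(congr1 (fun q : {poly L} => q`_1)); rewrite coef0 coef_sum.
  rewrite (bigD1 (Ordinal n_gt0)) //= coefXn eqxx big1 ?addr0 => [|i i_n0].
    by move/eqP; rewrite oner_eq0.
  rewrite coefXn eq_sym -{2}(expn0 2) eqn_exp2l //.
  by move: i_n0; rewrite -val_eqE /= => /negPf->.
have := max_poly_roots (rs := enum L) p_n0.
rewrite enum_uniq -cardE hL => lt_p; suff : false by [].
have : (2 ^ n < (2 ^ n.-1).+1)%N; last first.
  by rewrite ltnS leq_exp2l // -ltnS prednK // ltnn.
apply: leq_trans sz_p; apply: lt_p => //; apply/allP=> x _.
rewrite rootE horner_sum -[eqbRHS](eqP (negbNE (Tr0 x))).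
by apply/eqP/eq_bigr => i _; rewrite hornerXn.
Qed.

Definition chi (x : L) : int := sign (Tr x).

Lemma signD (x y : L) : sign (Tr x + Tr y) = sign (Tr x) * sign (Tr y).
Proof.
by rewrite /sign; case: (abs_trace01 x) (abs_trace01 y) => -> [] ->;
   rewrite ?addr0 ?add0r ?(addrr_pchar2 ch2) ?eqxx ?oner_eq0.
Qed.

Lemma chiD (x y : L) : chi (x + y) = chi x * chi y.
Proof. by rewrite /chi abs_traceD signD. Qed.

Lemma chi0 : chi 0 = 1.
Proof. by rewrite /chi abs_trace0 /sign eqxx. Qed.

Lemma chi_eq1 (x : L) : (chi x == 1) = (Tr x == 0).
Proof. by rewrite /chi /sign; case: (Tr x == 0). Qed.

Lemma chi_neq0 (x : L) : chi x != 0.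
Proof. by rewrite /chi /sign signr_eq0. Qed.

Lemma sum_chi_linear (w : L) :
  \sum_z chi (w * z) = if w == 0 then (2 ^ n)%:R else 0.
Proof.
have := @sum_character L setT (fun z => chi (w * z)); rewrite cardsT hL.
rewrite (eq_bigl predT) => [->|z]; rewrite ?inE //.
- case: eqVneq => [->|w_n0]; case: ifP => //.
    by move/negP; case; apply/forall_inP=> x _; rewrite mul0r chi0.
  have [z Tz] := abs_trace_nondegenerate w_n0.
  by move/forall_inP/(_ z (in_setT z)); rewrite chi_eq1 (negPf Tz).
- by move=> x y _ _; rewrite inE.
- exact: (addrr_pchar2 ch2).
- by move=> x _; apply: chi_neq0.
- by move=> x y _ _; rewrite mulrDr chiD.
Qed.
End AbsoluteTrace.

(** * Quadratic maps over a quadratic extension *)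

Section QuadraticExtension.
Variables (m : nat) (K L : finFieldType) (iota : {rmorphism K -> L}).
Hypotheses (hK : #|K| = (2 ^ m)%N) (hL : #|L| = (2 ^ (2 * m))%N).

Let m_gt0 : (0 < m)%N.
Proof. by case: m hK (finNzRing_gt1 K) => // ->. Qed.

Let ch2 : 2 \in [pchar L].
Proof. exact: card_finPcharP hL isT. Qed.

Let addxx (x : L) : x + x = 0.
Proof. exact: addrr_pchar2. Qed.

(** * The subfield and the relative trace *)

Lemma addr_eq0_pchar2 (x y : L) : (x + y == 0) = (x == y).
Proof. by rewrite addr_eq0 oppr_pchar2. Qed.

Lemma expr_card_ext (x : L) : (x ^+ (2 ^ m)) ^+ (2 ^ m) = x.
Proof. by rewrite -exprM -expnD addnn -mul2n -hL expf_card. Qed.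

(** The image of [iota] consists of 2^m roots of X^(2^m) - X, which has no more. *)
Lemma codom_iotaE (x : L) : (x \in codom iota) = (x ^+ (2 ^ m) == x).
Proof.
pose A := [set y | y \in codom iota]; pose B := [set y : L | y ^+ (2 ^ m) == y].
have sAB : A \subset B.
  apply/subsetP=> y; rewrite !inE => /codomP[z ->].
  by rewrite -rmorphXn /= -hK expf_card.
have cA : #|A| = (2 ^ m)%N by rewrite cardsE card_codom //; apply: fmorph_inj.
have cB : (#|B| <= 2 ^ m)%N.
  have lt1 : (1 < 2 ^ m)%N by rewrite -hK finNzRing_gt1.
  have sz : size ('X^(2 ^ m) - 'X : {poly L}) = (2 ^ m).+1.
    by rewrite size_polyDl ?size_polyXn // size_polyN size_polyX.
  have p_n0 : 'X^(2 ^ m) - 'X != 0 :> {poly L} by rewrite -size_poly_gt0 sz.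
  have := max_poly_roots (rs := enum B) p_n0.
  rewrite enum_uniq sz -cardE ltnS; apply=> //; apply/allP=> y.
  by rewrite mem_enum inE rootE !hornerE subr_eq0.
have /eqP AB : A == B by rewrite eqEcard sAB cA cB.
by have := in_set (mem (codom iota)) x; rewrite -/A AB inE.
Qed.

Lemma codom_iota_2pow (k : nat) (x : L) :
  (x ^+ (2 ^ k) \in codom iota) = (x \in codom iota).
Proof.
rewrite !codom_iotaE exprAC; apply/eqP/eqP => [|->//].
exact: (expr_2pow_inj hL).
Qed.

Lemma codom_iota0 : 0 \in codom iota.
Proof. by rewrite -(rmorph0 iota) codom_f. Qed.

Lemma codom_iotaD (x y : L) :
  x \in codom iota -> y \in codom iota -> x + y \in codom iota.
Proof. by case/codomP=> a -> /codomP[b ->]; rewrite -rmorphD codom_f. Qed.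

Lemma codom_iotaM (x y : L) :
  x \in codom iota -> y \in codom iota -> x * y \in codom iota.
Proof. by rewrite !codom_iotaE exprMn => /eqP-> /eqP->. Qed.

Lemma codom_iota_div (x y : L) :
  x \in codom iota -> y \in codom iota -> x / y \in codom iota.
Proof. by rewrite !codom_iotaE exprMn exprVn => /eqP-> /eqP->. Qed.

Local Notation T := (@rel_trace L m).

Lemma rel_traceD (x y : L) : T (x + y) = T x + T y.
Proof. by rewrite /rel_trace exprD_2pow //; ring. Qed.

Lemma rel_traceZ (c x : L) : c \in codom iota -> T (c * x) = c * T x.
Proof. by rewrite codom_iotaE /rel_trace exprMn => /eqP->; rewrite mulrDr. Qed.

Lemma rel_trace_codom (x : L) : T x \in codom iota.
Proof. by rewrite codom_iotaE exprD_2pow // expr_card_ext addrC. Qed.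

Lemma rel_trace_eq0 (x : L) : (T x == 0) = (x \in codom iota).
Proof. by rewrite codom_iotaE addr_eq0_pchar2 eq_sym. Qed.

Lemma rel_trace_2pow (k : nat) (x : L) : T (x ^+ (2 ^ k)) = T x ^+ (2 ^ k).
Proof. by rewrite exprD_2pow // exprAC. Qed.

Lemma card_codom_iota : #|codom iota| = (2 ^ m)%N.
Proof. by rewrite card_codom //; apply: fmorph_inj. Qed.

Lemma rel_trace_onto (y : L) : y \in codom iota -> exists x, T x = y.
Proof.
move=> Ky; have [a Ka] : exists a, a \notin codom iota.
  apply/existsP; rewrite -negb_forall; apply/negP=> /forallP KT.
  have : (#|codom iota| < #|L|)%N by rewrite card_codom_iota hL ltn_exp2l //; lia.
  by rewrite (eq_card (B := predT)) ?ltnn // => x; rewrite KT.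
have Ta : T a != 0 by rewrite rel_trace_eq0.
exists (y / T a * a); rewrite rel_traceZ ?divfK //.
by rewrite codom_iota_div // rel_trace_codom.
Qed.

(** * Polar form and derivatives *)

Variables (k : nat) (f F : L -> L).
(** f stands for Lambda extended to L and, later, for the monomial of condition III. Together the
    hypotheses on f make it a permutation of the subfield. *)
Hypothesis fD : {morph f : x y / x + y}.
Hypothesis f_codom : forall x, x \in codom iota -> f x \in codom iota.
Hypothesis f_eq0 : forall x, x \in codom iota -> f x = 0 -> x = 0.
Hypothesis FE : forall x, F x = x ^+ (2 ^ k) * f (T x).

Definition polar (s t : L) := s ^+ (2 ^ k) * f (T t) + t ^+ (2 ^ k) * f (T s).

Lemma polarE (x s : L) : F (x + s) + F x = F s + polar s x.
Proof.
rewrite !FE rel_traceD fD exprD_2pow // /polar.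
rewrite -[RHS]add0r -(addxx (x ^+ (2 ^ k) * f (T x))); ring.
Qed.

Let f0 : f 0 = 0.
Proof. by apply: (addrI (f 0)); rewrite -fD !addr0. Qed.

Lemma polarC (s t : L) : polar s t = polar t s.
Proof. exact: addrC. Qed.

Lemma polarDr (s t u : L) : polar s (t + u) = polar s t + polar s u.
Proof. rewrite /polar rel_traceD fD exprD_2pow //; ring. Qed.

Lemma polarxx (s : L) : polar s s = 0.
Proof. exact: addxx. Qed.

Lemma polar0 (s : L) : polar s 0 = 0.
Proof. by apply: (addrI (polar s 0)); rewrite -polarDr !addr0. Qed.

Definition polar_ker (s : L) := [set t | polar s t == 0].

Lemma pair_sub_polar_ker (a : L) : [set 0; a] \subset polar_ker a.
Proof. by rewrite subUset !sub1set !inE polar0 polarxx eqxx. Qed.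

Lemma card_polar_ker_ge2 (a : L) : a != 0 -> (2 <= #|polar_ker a|)%N.
Proof.
move=> a_n0; apply: leq_trans (subset_leq_card (pair_sub_polar_ker a)).
by rewrite cards2 eq_sym a_n0.
Qed.

(** By [polarE] the derivative in direction a is affine with linear part [polar a], so a nonempty
    fibre is a translate of the kernel. *)
Lemma delta_polar_ker (a b x0 : L) :
  F (x0 + a) + F x0 = b -> delta F a b = #|polar_ker a|.
Proof.
move=> Fx0; rewrite -(card_imset _ (addrI x0)); apply: eq_card => x.
rewrite inE -Fx0 !polarE [F a + _]addrC [F a + _]addrC.
rewrite (inj_eq (addIr _)) -addr_eq0_pchar2 -polarDr.
apply/idP/imsetP => [ax0|[t]].
  by exists (x0 + x); rewrite ?inE ?[x0 + x]addrC // addrCA addxx addr0.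
by rewrite inE => ker_t ->; rewrite [x0 + t]addrC -addrA addxx addr0.
Qed.

Lemma delta_le2P :
  (forall a b, a \notin codom iota -> delta F a b = 0%N \/ delta F a b = 2%N) <->
  (forall a, a \notin codom iota -> #|polar_ker a| = 2%N).
Proof.
split=> [dF a Ka|ker2 a b Ka].
  have a_n0 : a != 0 by apply: contraNneq Ka => ->; apply: codom_iota0.
  (* The fibre through 0 is nonempty, which excludes the value 0. *)
  have eqd := @delta_polar_ker a _ 0 erefl.
  case: (dF a (F (0 + a) + F 0) Ka); rewrite eqd // => ker0.
  by have := card_polar_ker_ge2 a_n0; rewrite ker0.
have [->|] := eqVneq (delta F a b) 0%N; [by left | rewrite -lt0n card_gt0].
by case/set0Pn=> x; rewrite inE => /eqP/delta_polar_ker->; right; apply: ker2.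
Qed.

Lemma card_polar_ker2P :
  (forall a, a \notin codom iota -> #|polar_ker a| = 2%N) <->
  (forall s t, s \in codom iota -> t \in codom iota -> s != 0 ->
     t ^+ (2 ^ k) * f s = s ^+ (2 ^ k) * f t -> t = 0 \/ t = s).
Proof.
split=> [ker2 s t Ks Kt s_n0 eq_st|inj_f a Ka].
  have [a Ta] := rel_trace_onto Ks.
  have Ka : a \notin codom iota by rewrite -rel_trace_eq0 Ta.
  have a_n0 : a != 0 by apply: contraNneq Ka => ->; apply: codom_iota0.
  have kerE : [set 0; a] = polar_ker a.
    by apply/eqP; rewrite eqEcard pair_sub_polar_ker ker2 // cards2 eq_sym a_n0.
  (* This multiple of a by an element of the subfield has relative trace t. *)
  have : t / s * a \in polar_ker a.
    rewrite inE /polar rel_traceZ ?codom_iota_div // Ta divfK // addr_eq0_pchar2.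
    apply/eqP; transitivity (t ^+ (2 ^ k) * f s / s ^+ (2 ^ k) * a ^+ (2 ^ k)).
      by rewrite eq_st; field; rewrite expf_neq0.
    by rewrite !exprMn exprVn; ring.
  rewrite -kerE !inE !mulf_eq0 invr_eq0 (negPf a_n0) (negPf s_n0) !orbF.
  case/orP=> [/eqP-> | /eqP ts]; [by left | right].
  by apply: (divIf s_n0); apply: (mulIf a_n0); rewrite ts divff // mul1r.
have Ta_n0 : T a != 0 by rewrite rel_trace_eq0.
have a_n0 : a != 0 by apply: contraNneq Ka => ->; apply: codom_iota0.
have fTa_n0 : f (T a) != 0.
  by apply: contra_neq Ta_n0; apply: f_eq0; apply: rel_trace_codom.
suff -> : polar_ker a = [set 0; a] by rewrite cards2 eq_sym a_n0.
apply/eqP; rewrite eqEsubset pair_sub_polar_ker andbT; apply/subsetP=> x.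
rewrite !inE addr_eq0_pchar2 => /eqP ker_x.
(* Some Frobenius power of x / a is a quotient of elements of the subfield, so x / a lies there too;
   hence T x = (x / a) T a. *)
have xaE : (x / a) ^+ (2 ^ k) = f (T x) / f (T a).
  apply: (mulIf fTa_n0); rewrite divfK // exprMn exprVn mulrAC -ker_x.
  by rewrite [_ * f _]mulrC mulfK ?expf_neq0.
have Kxa : x / a \in codom iota.
  by rewrite -(codom_iota_2pow k) xaE codom_iota_div ?f_codom ?rel_trace_codom.
have Tx : T x = x / a * T a by rewrite -rel_traceZ // divfK.
have [|||//||] := inj_f (T a) (T x); rewrite ?rel_trace_codom //.
- by rewrite {1}Tx exprMn xaE mulrC mulrA mulrAC; field; rewrite ?fTa_n0.
- rewrite Tx => /eqP; rewrite !mulf_eq0 (negPf Ta_n0) invr_eq0 (negPf a_n0) !orbF.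
  by move=> ->.
- rewrite Tx -[RHS]mul1r => /(mulIf Ta_n0) xa1.
  by rewrite -(divfK a_n0 x) xa1 mul1r eqxx orbT.
Qed.

Lemma f_onto (y : L) : y \in codom iota -> exists2 z, z \in codom iota & f z = y.
Proof.
pose A := [set x | x \in codom iota] => Ky.
have f_inj : {in A &, injective f}.
  move=> x z; rewrite !inE => Kx Kz eq_f; apply/eqP; rewrite -addr_eq0_pchar2.
  by apply/eqP/f_eq0; rewrite ?codom_iotaD ?fD ?eq_f.
have /eqP fA : f @: A == A.
  rewrite eqEcard card_in_imset // leqnn andbT.
  by apply/subsetP=> _ /imsetP[x Ax ->]; move: Ax; rewrite !inE; apply: f_codom.
have : y \in f @: A by rewrite fA inE.
by case/imsetP=> z; rewrite inE; exists z.
Qed.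

(** * Radicals and Walsh coefficients *)

Local Notation n := (2 * m)%N.
Local Notation chi := (@chi n L).

Lemma abs_trace_codom (x : L) : x \in codom iota -> abs_trace n x = 0.
Proof.
case/rel_trace_onto=> z <-.
by rewrite (abs_traceD hL) (abs_trace_2pow hL) addxx.
Qed.

(** The relative trace is self-adjoint for the trace form, because x |-> x^(2^m) is an involution
    preserving the absolute trace. *)
Lemma abs_trace_rel_trace (w z : L) :
  abs_trace n (w * T z) = abs_trace n (T w * z).
Proof.
rewrite /rel_trace mulrDr mulrDl !(abs_traceD hL); congr (_ + _).
by rewrite -(abs_trace_2pow hL m) exprMn expr_card_ext.
Qed.

Lemma rel_trace_eq0_of_orthogonal (w : L) :
  (forall y, y \in codom iota -> chi (w * y) = 1) -> T w = 0.
Proof.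
move=> orth; apply: contraTeq isT => /(abs_trace_nondegenerate hL)[z /eqP[]].
rewrite -abs_trace_rel_trace; apply/eqP; rewrite -chi_eq1.
by rewrite orth // rel_trace_codom.
Qed.

Definition radical (v : L) := [set s | [forall t, chi (v * polar s t) == 1]].

Lemma radicalP (v s : L) :
  reflect (forall t, chi (v * polar s t) = 1) (s \in radical v).
Proof. by rewrite inE; apply: (iffP forallP) => h t; apply/eqP/h. Qed.

Lemma radical0 (v : L) : 0 \in radical v.
Proof. by apply/radicalP=> t; rewrite polarC polar0 mulr0 (chi0 hL). Qed.

Lemma radicalD (v x y : L) :
  x \in radical v -> y \in radical v -> x + y \in radical v.
Proof.
move=> /radicalP Rx /radicalP Ry; apply/radicalP=> t.
by rewrite polarC polarDr mulrDr (chiD hL) ![_ t _]polarC Rx Ry.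
Qed.

Lemma sum_chi_polar (v s : L) :
  \sum_t chi (v * polar s t) = if s \in radical v then (2 ^ n)%:R else 0.
Proof.
transitivity (\sum_(t in [set: L]) chi (v * polar s t)).
  by apply: eq_bigl => t; rewrite inE.
rewrite (@sum_character _ setT) ?inE //.
- rewrite cardsT hL; congr (if _ then _ else _).
  by apply: eq_forallb => t; rewrite inE.
- by move=> t u _ _; rewrite inE.
- by move=> t _; apply: chi_neq0.
- by move=> t u _ _; rewrite polarDr mulrDr (chiD hL).
Qed.

Let g (u v x : L) := chi (v * F x + u * x).

Lemma walshE (u v : L) : walsh n F u v = \sum_x g u v x.
Proof. by apply: eq_bigr => x _; rewrite /g (chiD hL) signD. Qed.

(** Writing the second variable as x + s, the polarization splits off a character of x, whose sum is
    2^n if s is in the radical and 0 otherwise. *)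
Lemma walsh_sqr (u v : L) :
  walsh n F u v ^+ 2 = (2 ^ n)%:R * \sum_(s in radical v) g u v s.
Proof.
rewrite walshE expr2 mulr_suml.
transitivity (\sum_x \sum_s g u v s * chi (v * polar s x)).
  apply: eq_bigr => x _; rewrite mulr_sumr (reindex_inj (addrI x)) /=.
  apply: eq_bigr => s _; rewrite /g -!(chiD hL); congr chi.
  have := polarE x s; rewrite -[RHS]addr0 -(addxx (F x)) addrA => /addIr FD.
  rewrite FD -[RHS]add0r -(addxx (v * F x)) -[RHS]add0r -(addxx (u * x)); ring.
rewrite exchange_big mulr_sumr [RHS]big_mkcond /=; apply: eq_bigr => s _.
by rewrite -mulr_sumr sum_chi_polar; case: ifP; rewrite ?mulr0 // mulrC.
Qed.

(** On the radical the polar term is invisible to the character, so [g u v] is multiplicative there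
    and sums to the cardinal or to 0. *)
Lemma walsh_sqr_cases (u v : L) :
  walsh n F u v ^+ 2 = (2 ^ n * #|radical v|)%:R \/ walsh n F u v ^+ 2 = 0.
Proof.
rewrite walsh_sqr (@sum_character _ (radical v)) //.
- by case: ifP; rewrite ?mulr0; [left; rewrite natrM | right].
- exact: radical0.
- exact: radicalD.
- by move=> x _; apply: chi_neq0.
- move=> x y _ /radicalP Ry; rewrite /g -(chiD hL).
  have -> : F (x + y) = F x + F y + polar y x.
    have := polarE x y; rewrite -[RHS]addr0 -(addxx (F x)) addrA => /addIr->.
    by ring.
  by rewrite -[RHS]mulr1 -(Ry x) -(chiD hL); congr chi; ring.
Qed.

(** Otherwise every square is 0, whereas summing over u leaves only s = 0 and gives 2^n * 2^n
    (Parseval). *)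
Lemma walsh_sqr_attained (v : L) :
  exists u, walsh n F u v ^+ 2 = (2 ^ n * #|radical v|)%:R.
Proof.
apply/exists_eqP; apply: contraT => /existsPn none.
have : \sum_u walsh n F u v ^+ 2 = 0.
  apply: big1 => u _; case: (walsh_sqr_cases u v) => // /eqP.
  by rewrite (negPf (none u)).
under eq_bigr do rewrite walsh_sqr.
rewrite -mulr_sumr exchange_big (bigD1 0) ?radical0 //= [X in _ + X]big1.
  rewrite addr0 [X in _ * X](eq_bigr (fun=> 1)).
    rewrite sumr_const (eq_card (B := predT)) // hL -natrM => /eqP.
    by rewrite pnatr_eq0 muln_eq0 expn_eq0.
  have T0 : T 0 = 0 by apply/eqP; rewrite rel_trace_eq0 codom_iota0.
  move=> u _; rewrite /g FE T0.
  by rewrite f0 !mulr0 addr0 (chi0 hL).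
move=> s /andP[_ s_n0]; under eq_bigr do rewrite /g (chiD hL).
rewrite -mulr_sumr; under eq_bigr do rewrite mulrC.
by rewrite (sum_chi_linear hL) (negPf s_n0) mulr0.
Qed.


(** Testing s against t in the subfield gives f(T s) T v = 0, so s lies in the subfield. Then f(T t)
    runs over the whole subfield, which gives s^(2^k) T v = 0. *)
Lemma radical_notin_codom (v : L) : v \notin codom iota -> radical v = [set 0].
Proof.
rewrite -rel_trace_eq0 => Tv; apply/eqP; rewrite eqEsubset sub1set radical0 andbT.
apply/subsetP=> s /radicalP Rs; rewrite inE.
have Ts : s \in codom iota.
  have /eqP : T (v * f (T s)) = 0.
    apply: rel_trace_eq0_of_orthogonal => y Ky.
    have [z Kz zy] : exists2 z, z \in codom iota & z ^+ (2 ^ k) = y.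
      (* A 2^k-th root of y, since k + k (2m - 1) = 2mk. *)
      exists (y ^+ (2 ^ (k * (2 * m).-1))).
        by rewrite codom_iota_2pow.
      rewrite -exprM -expnD addnC -mulnS prednK ?muln_gt0 // mulnC.
      exact: expr_2powM hL.
    have := Rs z; rewrite /polar; have /eqP-> : T z == 0 by rewrite rel_trace_eq0.
    by rewrite f0 mulr0 add0r zy mulrCA mulrC.
  rewrite mulrC rel_traceZ ?f_codom ?rel_trace_codom // mulf_eq0 (negPf Tv) orbF.
  by rewrite -rel_trace_eq0 => /eqP/f_eq0->; rewrite ?rel_trace_codom.
have /eqP : T (v * s ^+ (2 ^ k)) = 0.
  apply: rel_trace_eq0_of_orthogonal => y /f_onto[z /rel_trace_onto[t <-] <-].
  have := Rs t; rewrite /polar; have /eqP-> : T s == 0 by rewrite rel_trace_eq0.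
  by rewrite f0 mulr0 addr0 mulrA.
rewrite mulrC rel_traceZ ?codom_iota_2pow // mulf_eq0 (negPf Tv) orbF.
by rewrite expf_eq0 => /andP[].
Qed.

Lemma codom_sub_radical (v : L) :
  v \in codom iota -> [set x | x \in codom iota] \subset radical v.
Proof.
move=> Kv; apply/subsetP=> s; rewrite inE => Ks; apply/radicalP=> t.
apply/eqP; rewrite chi_eq1 abs_trace_codom // codom_iotaM // /polar.
have /eqP-> : T s == 0 by rewrite rel_trace_eq0.
rewrite f0 mulr0 addr0.
by rewrite codom_iotaM ?codom_iota_2pow ?f_codom ?rel_trace_codom.
Qed.

Lemma card_radical_ge (v : L) :
  odd m -> v \in codom iota -> (2 ^ m.+1 <= #|radical v|)%N.
Proof.
move=> m_odd Kv; pose A := [set x | x \in codom iota].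
have cA : #|A| = (2 ^ m)%N by rewrite cardsE card_codom_iota.
have sAR : A \subset radical v := codom_sub_radical Kv.
have [s Rs As] : exists2 s, s \in radical v & s \notin A.
  apply/subsetPn; apply: contraL m_odd => sRA.
  have {sRA} RA : radical v = A by apply/eqP; rewrite eqEsubset sRA.
  have [u] := walsh_sqr_attained v; rewrite RA cA -expnD => Wu.
  have {Wu} : (`|walsh n F u v|%N ^ 2 = 2 ^ (n + m))%N.
    by rewrite -abszX Wu natz absz_nat.
  move/(congr1 (logn 2)); rewrite lognX pfactorK // => /(congr1 odd).
  by rewrite oddM oddD oddM /= => <-.
(* The radical contains the subfield and its coset through s, which doubles the bound. *)
have dA : [disjoint A & [set s + a | a in A]].
  rewrite -setI_eq0; apply/eqP/setP=> x; rewrite !inE; apply: contraNF As.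
  case/andP=> Kx /imsetP[a]; rewrite inE => Ka xE.
  have -> : s = x + a by rewrite xE -addrA addxx addr0.
  by rewrite inE codom_iotaD.
have sR : A :|: [set s + a | a in A] \subset radical v.
  rewrite subUset sAR; apply/subsetP=> _ /imsetP[a Aa ->].
  by rewrite radicalD // (subsetP sAR).
apply: leq_trans (subset_leq_card sR).
rewrite cardsU (disjoint_setI0 dA) cards0 subn0 card_imset; last exact: addrI.
by rewrite cA addnn expnS mul2n.
Qed.

(** * Double counting of radicals and kernels *)

Lemma sum_card_radical :
  (\sum_v #|radical v| = \sum_s #|polar_ker s|)%N.
Proof.
apply/eqP; rewrite -(eqn_pmul2l (expn_gt0 2 n)) -(eqr_nat int) !natrM !natr_sum.
rewrite !mulr_sumr; apply/eqP.
transitivity (\sum_(v : L) \sum_s \sum_t chi (v * polar s t)).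
  apply: eq_bigr => v _; rewrite -sum1_card natr_sum mulr_sumr [LHS]big_mkcond /=.
  by apply: eq_bigr => s _; rewrite sum_chi_polar; case: ifP; rewrite ?mulr1.
rewrite exchange_big; apply: eq_bigr => s _; rewrite exchange_big.
rewrite -sum1_card natr_sum mulr_sumr [RHS]big_mkcond /=; apply: eq_bigr => t _.
under eq_bigr do rewrite mulrC.
by rewrite (sum_chi_linear hL) inE; case: ifP; rewrite ?mulr1.
Qed.

Lemma polar_ker_codom (s : L) :
  s \in codom iota -> s != 0 -> polar_ker s = [set x | x \in codom iota].
Proof.
move=> Ks s_n0; apply/setP=> t; rewrite !inE /polar.
have /eqP-> : T s == 0 by rewrite rel_trace_eq0.
rewrite f0 mulr0 addr0 mulf_eq0.
rewrite expf_eq0 (negPf s_n0) andbF /= -rel_trace_eq0.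
apply/eqP/eqP => [/f_eq0->|->] //; exact: rel_trace_codom.
Qed.

Lemma card_notin_codom :
  #|[set x | x \notin codom iota]| = ((2 ^ m).-1 * 2 ^ m)%N.
Proof.
have := cardsC [set x | x \in codom iota]; rewrite cardsE card_codom_iota hL.
have -> : ~: [set x | x \in codom iota] = [set x | x \notin codom iota].
  by apply/setP=> x; rewrite !inE.
move=> eqn; rewrite -subn1 mulnBl mul1n -expnD addnn -mul2n -eqn addKn.
by [].
Qed.

Lemma sum_codom_unit (c : nat) :
  (\sum_(x in codom iota | x != 0%R) c = (2 ^ m).-1 * c)%N.
Proof.
transitivity (\sum_(x in [set x | x \in codom iota] :\ (0%R : L)) c)%N.
  by apply: eq_bigl => x; rewrite !inE andbC.
rewrite sum_nat_const; congr (_ * _)%N.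
have := cardsD1 (0 : L) [set x | x \in codom iota].
by rewrite cardsE card_codom_iota inE codom_iota0 => ->.
Qed.

(** In [sum_card_radical] the terms at 0 agree. The trivial radicals at v outside the subfield and
    the kernels at nonzero s inside it, each equal to the subfield, both total (2^m - 1) 2^m and
    cancel. *)
Lemma sum_card_radical_codom :
  (\sum_(v in codom iota | v != 0%R) #|radical v| =
   \sum_(s | s \notin codom iota) #|polar_ker s|)%N.
Proof.
have split0 (E : L -> nat) : (\sum_x E x = E 0%R +
    (\sum_(x in codom iota | x != 0%R) E x + \sum_(x | x \notin codom iota) E x))%N.
  rewrite (bigID (fun x => x \in codom iota)) (bigD1 0) ?addnA //=.
  exact: codom_iota0.
have := sum_card_radical; rewrite !split0.
have -> : radical 0 = polar_ker 0.
  apply/setP=> s; rewrite [RHS]inE polarC polar0 eqxx; apply/radicalP=> t.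
  by rewrite mul0r (chi0 hL).
move/eqP; rewrite eqn_add2l [eqbRHS]addnC => /eqP.
have -> : (\sum_(v | v \notin codom iota) #|radical v| = (2 ^ m).-1 * 2 ^ m)%N.
  rewrite -card_notin_codom -sum1_card; apply: eq_big => [v|v Kv]; first by rewrite inE.
  by rewrite radical_notin_codom // cards1.
suff -> : (\sum_(s in codom iota | s != 0%R) #|polar_ker s| = (2 ^ m).-1 * 2 ^ m)%N.
  by move/eqP; rewrite eqn_add2r => /eqP.
rewrite -sum_codom_unit; apply: eq_bigr => s /andP[Ks s_n0].
by rewrite polar_ker_codom // cardsE card_codom_iota.
Qed.


Lemma card_radicalP : odd m ->
  (forall a, a \notin codom iota -> #|polar_ker a| = 2%N) <->
  (forall v, v \in codom iota -> v != 0 -> #|radical v| = (2 ^ m.+1)%N).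
Proof.
move=> m_odd.
have kerP : (\sum_(a | a \notin codom iota) 2 <=
    \sum_(a | a \notin codom iota) #|polar_ker a|
    ?= iff [forall (a | a \notin codom iota), 2 == #|polar_ker a|])%N.
  apply: leqif_sum => a Ka; apply: leqif_eq; apply: card_polar_ker_ge2.
  by apply: contraNneq Ka => ->; apply: codom_iota0.
have radP : (\sum_(v in codom iota | v != 0%R) 2 ^ m.+1 <=
    \sum_(v in codom iota | v != 0%R) #|radical v|
    ?= iff [forall (v | (v \in codom iota) && (v != 0%R)), 2 ^ m.+1 == #|radical v|])%N.
  by apply: leqif_sum => v /andP[Kv _]; apply/leqif_eq/card_radical_ge.
have sum2 : (\sum_(a | a \notin codom iota) 2 =
    \sum_(v in codom iota | v != 0%R) 2 ^ m.+1)%N.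
  transitivity (\sum_(a in [set x | x \notin codom iota]) 2)%N.
    by apply: eq_bigl => a; rewrite inE.
  rewrite sum_codom_unit sum_nat_const card_notin_codom expnS.
  by rewrite [(2 * _)%N]mulnC mulnA.
have eq_extremal : [forall (a | a \notin codom iota), 2%N == #|polar_ker a|] =
    [forall (v | (v \in codom iota) && (v != 0)), (2 ^ m.+1)%N == #|radical v|].
  by rewrite -kerP -radP sum2 sum_card_radical_codom.
split=> [ker2 v Kv v_n0|rad a Ka].
  apply/esym/eqP; move: v {Kv v_n0}(introT andP (conj Kv v_n0)).
  by apply/forall_inP; rewrite -eq_extremal; apply/forall_inP => a Ka; rewrite ker2.
apply/esym/eqP; move: a Ka; apply/forall_inP; rewrite eq_extremal.
by apply/forall_inP => v /andP[Kv v_n0]; rewrite rad.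
Qed.

(** * The maximal nonlinearity *)

Lemma walsh_sqr_absz (u v : L) (N : nat) :
  walsh n F u v ^+ 2 = N%:R -> (`|walsh n F u v|%N ^ 2 = N)%N.
Proof. by move=> Wu; rewrite -abszX Wu natz absz_nat. Qed.

Lemma nonlinearityP : odd m ->
  nonlinearity n F = 2 ^+ (n - 1) - 2 ^+ ((n + m - 1) %/ 2) <->
  (forall v, v \in codom iota -> v != 0 -> #|radical v| = (2 ^ m.+1)%N).
Proof.
move=> m_odd; set e := ((n + m - 1) %/ 2)%N.
(* For m odd, n + m - 1 = 3m - 1 is even, so the division defining e is exact and 2 (e + 1) = n + m
   + 1. *)
have eE : ((2 ^ e.+1) ^ 2 = 2 ^ n * 2 ^ m.+1)%N.
  rewrite -expnM -expnD; congr (2 ^ _)%N; rewrite /e.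
  by rewrite -(odd_double_half m) m_odd; lia.
pose M := (\max_(u : L) \max_(v : L | v != 0%R) `|walsh n F u v|)%N.
have -> : nonlinearity n F = 2 ^+ (n - 1) - 2 ^+ e <-> M = (2 ^ e.+1)%N.
  rewrite /nonlinearity -/M; split=> [|->].
    move/addrI/oppr_inj => /(congr1 ( *%R 2)); rewrite mulVKf // -exprS -natrX.
    by move/eqP; rewrite eqr_nat => /eqP.
  by congr (_ - _); rewrite natrX exprS mulKf.
have W_le u v : v != 0 -> (`|walsh n F u v| <= M)%N.
  move=> v_n0; apply: leq_trans (leq_bigmax u).
  exact: (@leq_bigmax_cond _ (fun v => v != 0) (fun v => `|walsh n F u v|%N)).
split=> [ME v Kv v_n0|rad].
  apply/eqP; rewrite eqn_leq card_radical_ge // andbT.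
  have [u /walsh_sqr_absz Wu] := walsh_sqr_attained v.
  rewrite -(leq_pmul2l (expn_gt0 2 n)) -Wu -eE leq_sqr -ME.
  exact: W_le.
apply/eqP; rewrite eqn_leq; apply/andP; split.
  apply/bigmax_leqP => u _; apply/bigmax_leqP => v v_n0; rewrite -leq_sqr eE.
  have [/walsh_sqr_absz->|/(@walsh_sqr_absz _ _ 0)->//] := walsh_sqr_cases u v.
  rewrite leq_pmul2l ?expn_gt0 //; have [Kv|Kv] := boolP (v \in codom iota).
    by rewrite rad.
  by rewrite radical_notin_codom // cards1 expn_gt0.
have [u /walsh_sqr_absz Wu] := walsh_sqr_attained 1.
rewrite -leq_sqr eE -(rad 1) ?oner_neq0 -?(rmorph1 iota) ?codom_f //.
rewrite rmorph1 -Wu leq_sqr; apply: W_le; exact: oner_neq0.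
Qed.

End QuadraticExtension.

(** * The equivalences *)

Lemma linearized_reduce (p k : nat) (K : finFieldType) (e : 'I_k -> nat)
    (c : 'I_k -> K) : #|K| = (2 ^ p.+1)%N ->
  exists d : 'I_p.+1 -> K,
    forall y, \sum_i c i * y ^+ (2 ^ e i) = \sum_b d b * y ^+ (2 ^ b).
Proof.
move=> hK; pose h i : 'I_p.+1 := inord (e i %% p.+1).
exists (fun b => \sum_(i | h i == b) c i) => y.
rewrite (partition_big h predT) //=; apply: eq_bigr => b _.
rewrite mulr_suml; apply: eq_bigr => i /eqP<-.
by rewrite inordK ?ltn_pmod // (expr_2pow_mod _ _ hK).
Qed.

(** An element fixed by two powers of Frobenius is fixed by the one whose exponent is their gcd, by
    Bezout. *)
Lemma expr_2pow_coprime (L : comNzRingType) (a b : nat) (z : L) :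
    coprime a b -> (0 < b)%N -> z ^+ (2 ^ a) = z -> z ^+ (2 ^ b) = z ->
  z ^+ 2 = z.
Proof.
move=> co_ab b_gt0 za zb.
have iter c k : z ^+ (2 ^ c) = z -> z ^+ (2 ^ (k * c)) = z.
  by move=> zc; elim: k => // k IHk; rewrite mulSn expnD exprM zc.
case: (egcdnP a b_gt0) => kb ka; rewrite gcdnC (eqP co_ab) => eq_k _.
by rewrite -[RHS](iter b kb) // eq_k expnD exprM iter // expn1.
Qed.

(** This is the criterion of [card_polar_ker2P] for the monomial of condition III. The ratio z = (t
    / s)^(2^j) is fixed by Frobenius to the powers r' and m, hence is 0 or 1. *)
Lemma scaled_monomial_polar_ker (m r' j : nat) (K L : finFieldType)
    (iota : {rmorphism K -> L}) (gamma : K) (s t : L) :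
    #|K| = (2 ^ m)%N -> #|L| = (2 ^ (2 * m))%N -> coprime r' m ->
    gamma != 0 -> s \in codom iota -> t \in codom iota -> s != 0 ->
    t ^+ (2 ^ (j + r')) * (iota gamma * s ^+ (2 ^ j)) =
      s ^+ (2 ^ (j + r')) * (iota gamma * t ^+ (2 ^ j)) ->
  t = 0 \/ t = s.
Proof.
move=> hK hL co g_n0 Ks Kt s_n0.
have m_gt0 : (0 < m)%N by case: m hK (finNzRing_gt1 K) {hL co} => // ->.
have ig_n0 : iota gamma != 0 by rewrite fmorph_eq0.
rewrite ![_ * (iota gamma * _)]mulrCA => /(mulfI ig_n0).
rewrite expnD !exprM => eq_st.
have w_n0 : s ^+ (2 ^ j) != 0 by rewrite expf_neq0.
pose z := (t / s) ^+ (2 ^ j).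
have zr : z ^+ (2 ^ r') = z.
  rewrite /z !exprMn !exprVn; apply: (mulIf (expf_neq0 (2 ^ r') w_n0)).
  rewrite mulfVK ?expf_neq0 //; apply: (mulIf w_n0); rewrite eq_st.
  by rewrite mulrAC divfK // mulrC.
have zm : z ^+ (2 ^ m) = z.
  have : z \in codom iota by rewrite (codom_iota_2pow iota hK hL) (codom_iota_div hK).
  by rewrite (codom_iotaE iota hK) => /eqP.
have /eqP := expr_2pow_coprime co m_gt0 zr zm.
rewrite -subr_eq0 expr2 -{3}[z]mulr1 -mulrBr mulf_eq0 subr_eq0.
case/orP=> [|/eqP z1].
  by rewrite expf_eq0 mulf_eq0 invr_eq0 (negPf s_n0) orbF => /andP[_ /eqP->]; left.
right; apply: (divIf s_n0); rewrite divff //.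
by apply: (expr_2pow_inj (k := j) hL); rewrite expr1n.
Qed.

Theorem corollary9 (n m r : nat) (hn : n = (2 * m)%N)
    (K L : finFieldType) (iota : {rmorphism K -> L})
    (hK : #|K| = (2 ^ m)%N) (hL : #|L| = (2 ^ n)%N)
    (Lam : {poly K}) (hlin : linearized Lam)
    (hperm : bijective (fun y : K => Lam.[y]))
    (F : L -> L)
    (hF : forall x : L,
        F x = x ^+ (2 ^ r) * rel_trace m (map_poly iota Lam).[x]) :
  let condI :=
    nonlinearity n F = 2 ^+ (n - 1) - 2 ^+ ((n + m - 1) %/ 2) in
  let condII :=
    forall a b : L, a \notin codom iota ->
      delta F a b = 0%N \/ delta F a b = 2%N in
  let condIII :=
    exists (r' j : nat) (gamma : K),
      let G := fun x : L => x ^+ (2 ^ r') * rel_trace m x in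
      [/\ coprime r' m, gamma != 0 &
          forall x : L, F x = iota gamma * G (x ^+ (2 ^ j))] in
  (odd m -> (condI <-> condII) /\ (condII <-> condIII)) /\
  (~~ odd m -> (condII <-> condIII)).
Proof.
subst n; move=> condI condII condIII.
have chK : 2 \in [pchar K] := card_finPcharP hK isT.
have chL : 2 \in [pchar L] := card_finPcharP hL isT.
pose f x := (map_poly iota Lam).[x].
have [k0 [c LamE]] := hlin.
have fE x : f x = \sum_(i < k0) iota (c i) * x ^+ (2 ^ i).
  rewrite /f LamE rmorph_sum horner_sum; apply: eq_bigr => i _.
  by rewrite /= map_polyZ map_polyXn hornerZ hornerXn.
have fD : {morph f : x y / x + y}.
  move=> x y; rewrite !fE -big_split; apply: eq_bigr => i _.
  by rewrite exprD_2pow // mulrDr.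
have f_iota y : f (iota y) = iota Lam.[y] by rewrite /f horner_map.
have f_codom x : x \in codom iota -> f x \in codom iota.
  by case/codomP=> y ->; rewrite f_iota codom_f.
have Lam0 : Lam.[0] = 0.
  apply: (fmorph_inj iota); rewrite -f_iota rmorph0.
  by apply: (addrI (f 0)); rewrite -fD !addr0.
have Lam_eq0 y : Lam.[y] = 0 -> y = 0.
  by move=> Ly0; apply: (bij_inj hperm); rewrite /= Ly0 Lam0.
have f_eq0 x : x \in codom iota -> f x = 0 -> x = 0.
  case/codomP=> y ->; rewrite f_iota => /eqP.
  by rewrite fmorph_eq0 => /eqP/Lam_eq0->; rewrite rmorph0.
(* Lambda has coefficients in the subfield, so it commutes with the relative trace. *)
have FE x : F x = x ^+ (2 ^ r) * f (rel_trace m x).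
  rewrite hF; congr (_ * _); rewrite -/(f x) /rel_trace fD; congr (_ + _).
  rewrite !fE expr_2pow_sum //; apply: eq_bigr => i _.
  by rewrite exprMn exprAC -rmorphXn /= -hK expf_card.
have II_ker := delta_le2P iota hL fD FE.
have II_inj := iff_trans II_ker (card_polar_ker2P hK hL r fD f_codom f_eq0).
have I_II : odd m -> condI <-> condII.
  move=> m_odd; apply: (iff_trans (nonlinearityP hK hL fD f_codom f_eq0 FE m_odd)).
  apply: (iff_trans _ (iff_sym II_ker)); apply: iff_sym.
  exact: (card_radicalP hK hL fD f_codom f_eq0 FE m_odd).
(* The parity of m does not enter here, so one proof serves both (i) and (ii). *)
have II_III : condII <-> condIII; last first.
  by split=> [m_odd|_] //; split=> //; apply: I_II.
split=> [/II_inj inj_f|[r' [j [gamma [co_r' g_n0 FG]]]]]; last first.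
  pose f' y := iota gamma * y ^+ (2 ^ j).
  have f'D : {morph f' : x y / x + y} by move=> x y; rewrite /f' exprD_2pow // mulrDr.
  have FE' x : F x = x ^+ (2 ^ (j + r')) * f' (rel_trace m x).
    by rewrite FG (rel_trace_2pow hL) /f' expnD exprM mulrCA.
  apply/(delta_le2P iota hL f'D FE'); apply/(card_polar_ker2P hK hL _ f'D).
  - by move=> x Kx; rewrite (codom_iotaM hK) ?codom_f // (codom_iota_2pow iota hK hL).
  - move=> x _ /eqP; rewrite mulf_eq0 fmorph_eq0 (negPf g_n0) expf_eq0.
    by case/andP=> _ /eqP.
  - by move=> s t Ks Kt; apply: (scaled_monomial_polar_ker hK hL co_r' g_n0 Ks Kt).
rewrite /condIII; clear I_II II_ker II_inj condI condII condIII.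
case: m hK hL hF FE inj_f => [|p] hK hL hF FE inj_f.
  by have := finNzRing_gt1 K; rewrite hK.
(* Here m = p + 1 and r p + r = r m, so P is Lambda followed by the inverse of the r-th power of
   Frobenius; this reduces to the case r = 0. *)
pose rho := (r * p)%N.
pose P y := Lam.[y] ^+ (2 ^ rho).
have PK y : P y ^+ (2 ^ r) = Lam.[y].
  by rewrite /P -exprM -expnD -mulnSr mulnC (expr_2powM _ _ hK).
have [d dE] := linearized_reduce (fun i : 'I_k0 => i + rho)%N
  (fun i => c i ^+ (2 ^ rho)) hK.
have PE y : P y = \sum_b d b * y ^+ (2 ^ b).
  rewrite -dE /P LamE horner_sum expr_2pow_sum //; apply: eq_bigr => i _.
  by rewrite hornerZ hornerXn exprMn -exprM -expnD.
have P_n0 y : y != 0 -> P y != 0.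
  by move=> y_n0; rewrite expf_neq0 //; apply: contra_neq y_n0; apply: Lam_eq0.
have quo_inj : injective (fun y => P y / y).
  move=> y z /= eq_yz.
  have quo0 x : (P x / x == 0) = (x == 0).
    have [->|x_n0] := eqVneq x 0; first by rewrite invr0 mulr0 eqxx.
    by rewrite mulf_eq0 invr_eq0 (negPf x_n0) (negPf (P_n0 x x_n0)).
  have [y0|y_n0] := eqVneq y 0.
    by apply/esym/eqP; rewrite y0 -quo0 -eq_yz quo0 y0.
  have z_n0 : z != 0 by rewrite -quo0 -eq_yz quo0.
  have [||||iz0|] := inj_f (iota y) (iota z); rewrite ?codom_f ?fmorph_eq0 //.
  - rewrite !f_iota -!rmorphXn -!rmorphM; congr (iota _).
    rewrite -(PK y) -(PK z) -!exprMn; congr (_ ^+ _).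
    by rewrite -(divfK y_n0 (P y)) eq_yz -[in RHS](divfK z_n0 (P z)); ring.
  - by move/eqP: iz0; rewrite fmorph_eq0 (negPf z_n0).
  - by move/fmorph_inj.
have sum_n0 x : x != 0 -> \sum_b d b * x ^+ (2 ^ b) != 0 by rewrite -PE; apply: P_n0.
have sum_inj : injective (fun x => (\sum_b d b * x ^+ (2 ^ b)) / x).
  by move=> y z /=; rewrite -!PE; apply: quo_inj.
have [b [co_b db_n0 P_mono]] := linearized_quotient_inj hK sum_n0 sum_inj.
have fT x : f (rel_trace p.+1 x) =
    iota (d b ^+ (2 ^ r)) * rel_trace p.+1 (x ^+ (2 ^ (b + r))).
  have /codomP[y yE] := rel_trace_codom iota hK hL x.
  rewrite (rel_trace_2pow hL) yE f_iota -PK PE P_mono -rmorphXn -rmorphM.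
  by rewrite exprMn -exprM -expnD.
(* r' is a natural number representing -b modulo 2m, so that j + r' is r modulo 2m; it is coprime to
   m because b and 2m - 1 are. *)
exists (b * (2 * p.+1).-1)%N, (b + r)%N, (d b ^+ (2 ^ r)); split.
- have -> : (2 * p.+1).-1 = (p.+1 + p)%N by lia.
  by rewrite coprimeMl co_b coprime_sym /coprime gcdnDl -/(coprime _ _) coprimeSn.
- by rewrite expf_neq0.
move=> x; rewrite FE fT mulrCA; congr (_ * (_ * _)).
rewrite -exprM -expnD addnAC -mulnS prednK ?muln_gt0 // [(b * _)%N]mulnC.
by rewrite expnD exprM (expr_2powM _ _ hL).
Qed.
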